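(* Let $l\ge 1$ and let $x=(x_1,\dots,x_l)$ and $y=(y_1,\dots,y_l)$ be two $l$-dimensional boxes, i.e. arrays of positive integers. Let $R_{x+y}=\{(s_1,\dots,s_l)\in\mathbb{R}^l \mid 0\le s_i\le x_i+y_i \text{ for all } i\}$, and let $T=\mathbb{Z}^l\cap\partial R_{x+y}$ be the set of all integer points of the boundary of $R_{x+y}$. Then: (1) The set of possible attachments of the boxes $x$ and $y$ in the process of their aggregation is in one-to-one correspondence with the set $T$. (2) The number $|T|$ of all possible results of aggregations $x+y\to z$, counted with multiplicities (i.e. one for each attachment), is $$|T|=\prod_{i=1}^{l}(x_i+y_i+1)-\prod_{i=1}^{l}(x_i+y_i-1).$$ (3) The correspondence in (1) can be taken such that if $s=(s_1,\dots,s_l)\in T$ is the parameter of an attachment and $z(s)$ is the result of aggregation it produces, then $z(s)=(z_{x_1,y_1}(s_1),\dots,z_{x_l,y_l}(s_l))$, where $$z_{x_i,y_i}(s_i)=\max(x_i,\;y_i,\;x_i+y_i-s_i,\;s_i).$$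
   Context: An $l$-dimensional box $x=(x_1,\dots,x_l)\in\mathbb{Z}_{>0}^l$ is a Cartesian product of $l$ intervals parallel to the coordinate axes of $\mathbb{R}^l$, with integer side lengths $x_1,\dots,x_l$ (in this order) and with vertices in the lattice $\mathbb{Z}^l$; boxes are identified with their arrays of side lengths. Attachments: keep the box $x$ in a fixed position and translate the box $y$ (without rotation) by lattice vectors. A position of $y$ is an attachment of $x$ and $y$ if the two boxes are placed next to each other (their interiors are disjoint), all vertices lie in $\mathbb{Z}^l$, and the boundaries of the two boxes have at least one common lattice point. Different positions of $y$ are different attachments. The result of aggregation produced by an attachment is the box $z=(z_1,\dots,z_l)$ given by the side lengths of the minimal axis-aligned bounding box of the union of the two attached boxes; one writes $x+y\to z$. *)

(* Defs.v *)
From HB Require Import structures.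
From mathcomp Require Import all_boot all_order all_algebra.
From mathcomp Require Import finmap.
From mathcomp Require Import all_classical all_reals all_analysis.

Set Implicit Arguments.
Unset Strict Implicit.
Unset Printing Implicit Defensive.

Import Order.TTheory GRing.Theory Num.Theory.
Import numFieldNormedType.Exports.

Local Open Scope classical_set_scope.
Local Open Scope ring_scope.

Definition is_box (l : nat) (x : 'rV[int]_l) : Prop := forall i, 0 < x 0 i.

Definition boundary (T : topologicalType) (A : set T) : set T :=
  closure A `\` interior A.

Section Geometry.
Variables (R : realType) (l : nat).
Implicit Types (a b c x y z s t : 'rV[int]_l) (lo hi : 'rV[R]_l).

Definition lattice_point a : 'rV[R]_l := map_mx intr a.

Definition axis_box lo hi : set 'rV[R]_l :=
  [set p | forall i, lo 0 i <= p 0 i <= hi 0 i].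

(* The box x in the position with smallest vertex a.  Since a and x are
   integral, all the vertices of the placed box lie in the lattice. *)
Definition placed a x : set 'rV[R]_l :=
  axis_box (lattice_point a) (lattice_point (a + x)).

(* With x kept at a, the position of y with smallest vertex b is an
   attachment. *)
Definition is_attachment a x y b : Prop :=
  interior (placed a x) `&` interior (placed b y) = set0 /\
  exists p : 'rV[int]_l,
    boundary (placed a x) (lattice_point p) /\
    boundary (placed b y) (lattice_point p).

Definition attachments a x y : set 'rV[int]_l :=
  [set b | is_attachment a x y b].

Definition is_bounding_box (U B : set 'rV[R]_l) : Prop :=
  U `<=` B /\ forall lo hi, U `<=` axis_box lo hi -> B `<=` axis_box lo hi.

(* x placed at a and y placed at b aggregate into z. *)
Definition aggregates a x b y z : Prop :=
  is_box z /\
  exists c, is_bounding_box (placed a x `|` placed b y) (placed c z).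

(* All results of x + y -> z with multiplicities: each result is tagged with
   the attachment producing it. *)
Definition aggregations a x y : set ('rV[int]_l * 'rV[int]_l) :=
  [set bz | is_attachment a x y bz.1 /\ aggregates a x bz.1 y bz.2].

Definition sum_region x y : set 'rV[R]_l :=
  [set s | forall i, 0 <= s 0 i <= (x 0 i + y 0 i)%:~R].

(* Integer points of R^l are represented by their integer coordinates. *)
Definition parameters x y : set 'rV[int]_l :=
  [set s | boundary (sum_region x y) (lattice_point s)].

End Geometry.

Definition zcoord (xi yi si : int) : int :=
  Num.max xi (Num.max yi (Num.max (xi + yi - si) si)).

(* Main.v *)
(** Parametrise a position of [y] by [s = b - a + y], where [a] and [b] are the
    smallest vertices of [x] and [y]: coordinatewise the two boxes meet iff
    [0 <= s i <= x i + y i], and their interiors are disjoint iff some [s i]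
    is an end of this interval.  For boxes in contact, [max (a, b)] is always a
    common boundary lattice point.  The parameters are thus the points of
    a lattice box [prod [0, x i + y i]] outside the box
    [prod [1, x i + y i - 1]]. *)
Require Import Defs.
From HB Require Import structures.
From mathcomp Require Import all_boot all_order all_algebra.
From mathcomp Require Import finmap.
From mathcomp Require Import all_classical all_reals all_analysis.
From mathcomp Require Import lra zify.
Import Order.TTheory GRing.Theory Num.Theory.
Import numFieldNormedType.Exports.
Local Open Scope classical_set_scope.
Local Open Scope ring_scope.

(* [mxE] leaves entries whose type is [GRing.Nmodule.sort _] rather than [int],
   which [lia] does not identify with the other entries. *)
Lemma row_intD (l : nat) (u v : 'rV[int]_l) i : (u + v) 0 i = u 0 i + v 0 i.
Proof. exact: mxE. Qed.

Lemma row_intN (l : nat) (u : 'rV[int]_l) i : (- u) 0 i = - u 0 i.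
Proof. exact: mxE. Qed.

Definition row_intE := (row_intD, row_intN, @mxE).

(** * Cardinalities of finite products of intervals *)

Lemma card_ord_itv (c d n : nat) : (d <= n)%N ->
  #|[pred k : 'I_n | c <= k < d]%N| = (d - c)%N.
Proof.
move=> dn; rewrite -[RHS]muln1 -sum_nat_const_nat (big_nat_widenl _ 0) //.
by rewrite (big_nat_widen _ _ _ _ _ dn) big_mkord -sum1_card.
Qed.

(** Such a family models the natural points of a box. All coordinates share the codomain ['I_n], so
    [n] has to bound every upper end. *)
Lemma card_family_itv (l n : nat) (c d : 'I_l -> nat) :
  (forall i, d i <= n)%N ->
  #|family (fun i => [pred k : 'I_n | c i <= k < d i]%N)| =
  (\prod_i (d i - c i))%N.
Proof.
move=> dn; rewrite card_family foldrE big_map big_enum /=.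
by apply: eq_bigr => i _; exact: card_ord_itv.
Qed.

(** Carries counts from finite types over to classical sets. *)
Lemma card_eq_set_of (T : finType) (S : {set T}) :
  ([set` S] #= `I_#|S|)%card.
Proof.
have -> : [set` S] = [set` [fset x in S]%fset].
  by apply/seteqP; split=> x /=; rewrite !inE.
by apply/card_eq_fsetP; rewrite card_finset.
Qed.

(** * Topology of real boxes *)

(** Neighbourhoods of a row are generated by products of neighbourhoods of its entries, so an
    interior point can be moved along one axis alone, which makes the inequalities strict.
    Conversely, a product of open intervals is a neighbourhood inside the box. *)
Lemma interior_axis_box (R : realType) (l : nat) (lo hi p : 'rV[R]_l) :
  interior (axis_box lo hi) p <-> forall i, lo 0 i < p 0 i < hi 0 i.
Proof.
split=> [[P pP sP] i|loPhi].
  have /nbhs_ballP[e /= e0 eP] := pP 0 i.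
  have inP t : ball (p 0 i) e t -> lo 0 i <= t <= hi 0 i.
    move=> /eP Pt.
    have /sP/(_ i) : [set M : 'rV[R]_l | forall k j, P k j (M k j)]
        (\row_j if j == i then t else p 0 j).
      move=> k j; rewrite mxE (ord1 k).
      by case: eqP => [->//|_]; exact: nbhs_singleton (pP 0 j).
    by rewrite mxE eqxx.
  (* Moving entry [i] by [e / 2] either way stays in the box, hence both bounds are strict. *)
  have /inP loP : ball (p 0 i) e (p 0 i - e / 2).
    by rewrite /ball/= opprB addrC subrK gtr0_norm; lra.
  have /inP hiP : ball (p 0 i) e (p 0 i + e / 2).
    by rewrite /ball/= opprD addNKr normrN gtr0_norm; lra.
  lra.
exists (fun _ j => `]lo 0 j, hi 0 j[%classic) => [k j|M inM i].
  rewrite (ord1 k); apply: open_nbhs_nbhs; split; first exact: interval_open.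
  by rewrite /= in_itv /=.
by have := inM 0 i; rewrite /= in_itv /= => /andP[/ltW -> /ltW ->].
Qed.

Lemma closed_axis_box (R : realType) (l : nat) (lo hi : 'rV[R]_l) :
  closed (axis_box lo hi).
Proof.
move=> p cl i; rewrite !leNgt -negb_or; apply/negP => out.
have : nbhs p [set q : 'rV[R]_l | (q 0 i < lo 0 i) || (hi 0 i < q 0 i)].
  have coordN A : nbhs (p 0 i) A -> nbhs p [set q : 'rV[R]_l | A (q 0 i)].
    exact: (@coord_continuous R 1 l 0 i p).
  by case/orP: out => [/lt_nbhsl|/lt_nbhsr] /coordN; apply: filterS => q /= ->;
    rewrite ?orbT.
by move=> /cl[q [/(_ i)/andP[lq qh] /=]]; rewrite !ltNge lq qh.
Qed.

(** The box is its own closure, so a boundary point is a point of the box at which some strict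
    inequality of the interior fails. *)
Lemma boundary_axis_box (R : realType) (l : nat) (lo hi p : 'rV[R]_l) :
  boundary (axis_box lo hi) p <->
  axis_box lo hi p /\ exists i, p 0 i = lo 0 i \/ p 0 i = hi 0 i.
Proof.
rewrite /boundary -((closure_id _).1 (@closed_axis_box R l lo hi)).
split=> [[inp nint]|[inp [i ends]]]; split=> //.
  apply: contrapT => noends; apply: nint; apply/interior_axis_box => i.
  have /andP[lop phi] := inp i.
  rewrite !lt_neqAle lop phi !andbT; apply/andP; split; apply/eqP => e;
    by apply: noends; exists i; auto.
by move=> /interior_axis_box/(_ i); case: ends => ->; rewrite ltxx ?andbF.
Qed.

(** * Boxes with lattice vertices *)

Section Placed.
Variables (R : realType) (l : nat).
Local Notation placed := (@placed R l).
Local Notation sum_region := (@sum_region R l).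
Implicit Types a b c p x y z s : 'rV[int]_l.

Lemma placed_lattice a x p :
  placed a x (lattice_point R p) <->
  forall i, a 0 i <= p 0 i <= a 0 i + x 0 i.
Proof.
by split=> + i => /(_ i); rewrite !mxE ?ler_int.
Qed.

Lemma boundary_placed a x p :
  boundary (placed a x) (lattice_point R p) <->
  (forall i, a 0 i <= p 0 i <= a 0 i + x 0 i) /\
  exists i, p 0 i = a 0 i \/ p 0 i = a 0 i + x 0 i.
Proof.
rewrite boundary_axis_box -placed_lattice.
have -> // : (exists i, lattice_point R p 0 i = lattice_point R a 0 i \/
    lattice_point R p 0 i = lattice_point R (a + x) 0 i) <->
  exists i, p 0 i = a 0 i \/ p 0 i = a 0 i + x 0 i.
by split=> -[i e]; exists i; move: e; rewrite !mxE => -[/eqP|/eqP];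
  rewrite ?eqr_int => /eqP; auto => ->; auto.
Qed.

Lemma sum_region_placed x y : sum_region x y = placed 0 (x + y).
Proof.
by apply/seteqP; split=> p + i => /(_ i); rewrite !mxE add0r.
Qed.

Lemma parametersP x y s :
  parameters R x y s <->
  (forall i, 0 <= s 0 i <= x 0 i + y 0 i) /\
  exists i, s 0 i = 0 \/ s 0 i = x 0 i + y 0 i.
Proof.
rewrite /parameters /= sum_region_placed boundary_placed.
by split=> -[inT [i e]]; (split; last exists i) => [j|];
  try (move: (inT j)); move: e; rewrite !mxE ?add0r.
Qed.

(** Without a separating axis the boxes overlap in an interval of positive length along every axis,
    and the midpoints of these intervals form a common interior point. *)
Lemma disjoint_interiors a x b y : is_box x -> is_box y ->
  interior (placed a x) `&` interior (placed b y) = set0 <->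
  exists i, a 0 i + x 0 i <= b 0 i \/ b 0 i + y 0 i <= a 0 i.
Proof.
move=> hx hy; split=> [dis|[i sep]].
  apply: contrapT => nosep.
  have ov i : Num.max (a 0 i) (b 0 i) <
      Num.min (a 0 i + x 0 i) (b 0 i + y 0 i).
    have lt1 : b 0 i < a 0 i + x 0 i.
      by rewrite ltNge; apply/negP => ?; apply: nosep; exists i; left.
    have lt2 : a 0 i < b 0 i + y 0 i.
      by rewrite ltNge; apply/negP => ?; apply: nosep; exists i; right.
    have := hx i; have := hy i; lia.
  pose u i := Num.max (a 0 i) (b 0 i).
  pose v i := Num.min (a 0 i + x 0 i) (b 0 i + y 0 i).
  have bnd i : [/\ a 0 i <= u i, b 0 i <= u i, u i < v i,
      v i <= a 0 i + x 0 i & v i <= b 0 i + y 0 i].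
    by split; rewrite /u /v ?le_max ?ge_min ?lexx ?orbT.
  (* The midpoint is half-integral in general, so it has to be taken in [R]. *)
  pose m : 'rV[R]_l := \row_i (((u i)%:~R + (v i)%:~R) / 2).
  suff : set0 m by [].
  rewrite -dis; split; apply/interior_axis_box => i; rewrite !mxE;
    case: (bnd i); rewrite -!(ler_int R) -(ltr_int R); lra.
rewrite -subset0 => p [/interior_axis_box/(_ i) pa /interior_axis_box/(_ i) pb].
move: pa pb; rewrite !mxE.
by case: sep; rewrite -(ler_int R); lra.
Qed.

(** * Attachments and their parameters *)

Lemma is_attachmentP a x y b : is_box x -> is_box y ->
  is_attachment R a x y b <-> parameters R x y (b - a + y).
Proof.
move=> hx hy; rewrite parametersP; split.
  move=> [/(disjoint_interiors _ _ _ _ hx hy)[i sep] [p []]].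
  move=> /boundary_placed[pa _] /boundary_placed[pb _].
  split=> [j|].
    by rewrite !row_intE; have := pa j; have := pb j; lia.
  exists i; rewrite !row_intE; have := pa i; have := pb i.
  by case: sep; [right|left]; lia.
move=> [inT [i ends]].
have {}inT j : a 0 j <= b 0 j + y 0 j /\ b 0 j <= a 0 j + x 0 j.
  by have := inT j; rewrite !row_intE; lia.
have {}ends : b 0 i + y 0 i = a 0 i \/ b 0 i = a 0 i + x 0 i.
  by move: ends; rewrite !row_intE; lia.
split; first by apply/disjoint_interiors => //; exists i; lia.
(* This is the smallest vertex of the intersection. Along axis [i] the two intervals share only an
   end, which is this maximum, so the point is on both boundaries. *)
exists (\row_j Num.max (a 0 j) (b 0 j)).
split; apply/boundary_placed; split=> [j|].
- by rewrite row_intE; have := inT j; have := hx j; lia.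
- by exists i; rewrite row_intE; have := hx i; have := hy i; lia.
- by rewrite row_intE; have := inT j; have := hy j; lia.
- by exists i; rewrite row_intE; have := hx i; have := hy i; lia.
Qed.

(** The map is the inverse of [b - a + y]. *)
Lemma att_bij a x y : is_box x -> is_box y ->
  set_bij (parameters R x y) (attachments R a x y) (fun s => a - y + s).
Proof.
move=> hx hy; split.
- move=> s Ts; apply/is_attachmentP => //.
  by rewrite -[_ - a + y]addrA [- a + y]addrC -[y - a]opprB addrAC subrr add0r.
- by move=> s t _ _; exact: addrI.
- move=> b /(is_attachmentP _ _ _ _ hx hy) Tb; exists (b - a + y) => //.
  by rewrite -[b - a + y]addrA [- a + y]addrC -[y - a]opprB subrKC.
Qed.

(** * Results of aggregation *)

(** A bounding box contains the extreme vertices of both boxes and, by minimality, lies in the box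
    from [lo] to [hi]; this fixes its sides. *)
Lemma aggregatesP a x b y z : is_box x -> is_box y ->
  @aggregates R l a x b y z <->
  z = \row_i (Num.max (a 0 i + x 0 i) (b 0 i + y 0 i)
              - Num.min (a 0 i) (b 0 i)).
Proof.
move=> hx hy.
pose lo : 'rV[int]_l := \row_i Num.min (a 0 i) (b 0 i).
pose hi : 'rV[int]_l := \row_i Num.max (a 0 i + x 0 i) (b 0 i + y 0 i).
have subU c z' : (forall i, c 0 i <= lo 0 i) ->
    (forall i, hi 0 i <= c 0 i + z' 0 i) ->
    placed a x `|` placed b y `<=` placed c z'.
  move=> cl ch p pU i; rewrite !row_intE.
  have := cl i; have := ch i; rewrite /lo /hi !row_intE.
  rewrite le_min ge_max => /andP[h1 h2] /andP[h3 h4].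
  by case: pU => /(_ i); rewrite !row_intE; move: h1 h2 h3 h4;
    rewrite -!(ler_int R); lra.
split=> [[hz [c [Usub Bmin]]]|zE].
  have aU : (placed a x `|` placed b y) (lattice_point R a).
    by left; apply/placed_lattice => i; have := hx i; lia.
  have axU : (placed a x `|` placed b y) (lattice_point R (a + x)).
    by left; apply/placed_lattice => i; rewrite row_intE; have := hx i; lia.
  have bU : (placed a x `|` placed b y) (lattice_point R b).
    by right; apply/placed_lattice => i; have := hy i; lia.
  have byU : (placed a x `|` placed b y) (lattice_point R (b + y)).
    by right; apply/placed_lattice => i; rewrite row_intE; have := hy i; lia.
  have cub : placed c z `<=` placed lo (hi - lo).
    by apply/Bmin/subU => i; rewrite // !row_intE; lia.
  have cc : placed c z (lattice_point R c).
    by apply/placed_lattice => i; have := hz i; lia.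
  have cz : placed c z (lattice_point R (c + z)).
    by apply/placed_lattice => i; rewrite row_intE; have := hz i; lia.
  (* Four vertices of the union bound the box from inside, and its own two extreme vertices bound it
     from outside. *)
  move/Usub/placed_lattice: aU; move/Usub/placed_lattice: axU.
  move/Usub/placed_lattice: bU; move/Usub/placed_lattice: byU.
  move/cub/placed_lattice: cc; move/cub/placed_lattice: cz.
  move=> h1 h2 h3 h4 h5 h6; apply/rowP => i.
  have := h1 i; have := h2 i; have := h3 i; have := h4 i; have := h5 i.
  by have := h6 i; rewrite !row_intE; lia.
have hiE : hi = lo + z by apply/rowP => i; rewrite zE !row_intE; lia.
split; first by move=> i; rewrite zE mxE; have := hx i; lia.
exists lo; split; first by apply: subU => i //; rewrite hiE mxE.
move=> p q Usub r rB i.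
have inU t : placed a x t \/ placed b y t -> p 0 i <= t 0 i <= q 0 i.
  by move=> /Usub.
have := rB i; rewrite -hiE !row_intE => rlh.
(* Each of [lo 0 i] and [hi 0 i] is a coordinate of an extreme vertex of one of the two boxes, so it
   suffices to bound these vertices. *)
have aB : p 0 i <= (a 0 i)%:~R <= q 0 i.
  have := inU (lattice_point R a); rewrite row_intE; apply; left.
  by apply/placed_lattice => j; have := hx j; lia.
have axB : p 0 i <= (a 0 i + x 0 i)%:~R <= q 0 i.
  have := inU (lattice_point R (a + x)); rewrite !row_intE; apply; left.
  by apply/placed_lattice => j; rewrite row_intE; have := hx j; lia.
have bB : p 0 i <= (b 0 i)%:~R <= q 0 i.
  have := inU (lattice_point R b); rewrite row_intE; apply; right.
  by apply/placed_lattice => j; have := hy j; lia.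
have byB : p 0 i <= (b 0 i + y 0 i)%:~R <= q 0 i.
  have := inU (lattice_point R (b + y)); rewrite !row_intE; apply; right.
  by apply/placed_lattice => j; rewrite row_intE; have := hy j; lia.
by move: rlh; case: (leP (a 0 i) (b 0 i)) => _;
  case: (leP (a 0 i + x 0 i) (b 0 i + y 0 i)) => _; lra.
Qed.

(** After subtracting [a], a side is [max (x, s) - min (0, s - y) = max (x, s) + max (0, y - s)],
    which expands into the four terms of [zcoord]. *)
Lemma aggregates_att a x y s z : is_box x -> is_box y ->
  @aggregates R l a x (a - y + s) y z <->
  z = \row_(i < l) zcoord (x 0 i) (y 0 i) (s 0 i).
Proof.
move=> hx hy; rewrite aggregatesP //.
suff -> : \row_i (Num.max (a 0 i + x 0 i) ((a - y + s) 0 i + y 0 i)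
    - Num.min (a 0 i) ((a - y + s) 0 i)) =
  \row_(i < l) zcoord (x 0 i) (y 0 i) (s 0 i) by [].
by apply/rowP => i; rewrite /zcoord !row_intE; lia.
Qed.

(** * Counting the parameters *)

Lemma card_parameters x y : is_box x -> is_box y ->
  exists2 n, (parameters R x y #= `I_n)%card &
    Posz n = \prod_(i < l) (x 0 i + y 0 i + 1)
             - \prod_(i < l) (x 0 i + y 0 i - 1).
Proof.
move=> hx hy.
pose m i := absz (x 0 i + y 0 i).
have mE i : Posz (m i) = x 0 i + y 0 i.
  by rewrite /m; have := hx i; have := hy i; lia.
have m2 i : (1 < m i)%N by have := mE i; have := hx i; have := hy i; lia.
(* One codomain for all coordinates: the sum bounds every [m i], and the successor makes room for
   the value [m i] itself. *)
pose M := (\sum_i m i).+1.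
have mM i : (m i < M)%N by rewrite /M ltnS (bigD1 i) //= leq_addr.
pose A := [set f | f \in family
  (fun i => [pred k : 'I_M | 0 <= k < (m i).+1]%N)]%SET.
pose B := [set f | f \in family
  (fun i => [pred k : 'I_M | 1 <= k < m i]%N)]%SET.
have BA : B \subset A.
  apply/fintype.subsetP => f; rewrite !inE => /familyP fB; apply/familyP => i.
  by have := fB i; rewrite !inE => /andP[_ /ltnW].
have cardA : Posz #|A| = \prod_(i < l) (x 0 i + y 0 i + 1).
  rewrite cardsE card_family_itv // -[LHS]natz natr_prod.
  by apply: eq_bigr => i _; rewrite natz -mE; lia.
have cardB : Posz #|B| = \prod_(i < l) (x 0 i + y 0 i - 1).
  rewrite cardsE card_family_itv => [|i]; last exact: ltnW.
  rewrite -[LHS]natz natr_prod.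
  by apply: eq_bigr => i _; rewrite natz -mE; have := m2 i; lia.
exists #|A :\: B|; last first.
  (* The inclusion of [B] in [A] keeps the subtraction of naturals from truncating. *)
  rewrite -cardA -cardB cardsD (finset.setIidPr BA).
  by have := subset_leq_card BA; lia.
pose g (f : {ffun 'I_l -> 'I_M}) : 'rV[int]_l := \row_i Posz (f i).
have gE f i : g f 0 i = Posz (f i) by rewrite mxE.
have -> : parameters R x y = g @` [set` A :\: B].
  apply/seteqP; split=> [s /parametersP[inT [i ends]]|_ [f /= + <-]].
    (* Neither [absz] nor [inord] alters the value, since [0 <= s 0 i <= m i < M]. *)
    exists [ffun i => inord (absz (s 0 i))].
      rewrite /= !inE; apply/andP; split; last first.
        apply/familyP => j; rewrite ffunE inE inordK.
          by have := inT j; have := mE j; lia.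
        by have := inT j; have := mE j; have := mM j; lia.
      (* At the index [i] the entry of [s] is [0] or [m i], both excluded from [B]. *)
      apply/negP => /familyP /(_ i); rewrite ffunE inE inordK.
        by have := inT i; have := mE i; lia.
      by have := inT i; have := mE i; have := mM i; lia.
    apply/rowP => j; rewrite gE ffunE inordK.
      by have := inT j; have := mE j; lia.
    by have := inT j; have := mE j; have := mM j; lia.
  rewrite !inE => /andP[nB /familyP fA]; apply/parametersP.
  have {}fA i : 0 <= g f 0 i <= x 0 i + y 0 i.
    by rewrite gE -mE; have := fA i; rewrite inE.
  split=> //; apply: contrapT => noends.
  move/negP: nB; apply; apply/familyP => i.
  have : 0 < g f 0 i < Posz (m i).
    have n0 : g f 0 i <> 0 by move=> e; apply: noends; exists i; left.
    have nm : g f 0 i <> x 0 i + y 0 i.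
      by move=> e; apply: noends; exists i; right.
    by have := fA i; have := mE i; lia.
  by rewrite gE inE.
apply: card_eq_trans (inj_card_eq _) _.
  move=> f h _ _ /rowP fh; apply/ffunP => i; apply/val_inj.
  by have := fh i; rewrite !gE => -[].
exact: card_eq_set_of.
Qed.
End Placed.

(** * Bijection, count and formula together *)

Theorem proposition3p2 (R : realType) (l : nat) (hl : (1 <= l)%N)
    (x y : 'rV[int]_l) (hx : is_box x) (hy : is_box y)
    (a : 'rV[int]_l) :
  let T := parameters R x y in
  let N := \prod_(i < l) (x 0 i + y 0 i + 1)
           - \prod_(i < l) (x 0 i + y 0 i - 1) in
  [/\ (exists att : 'rV[int]_l -> 'rV[int]_l,
         set_bij T (attachments R a x y) att),
      [/\ finite_set T, Posz #|` fset_set T| = N,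
          finite_set (aggregations R a x y) &
          Posz #|` fset_set (aggregations R a x y)| = N] &
      (exists att : 'rV[int]_l -> 'rV[int]_l,
         set_bij T (attachments R a x y) att /\
         forall s, T s -> forall z : 'rV[int]_l,
           aggregates R a x (att s) y z <->
           z = \row_(i < l) zcoord (x 0 i) (y 0 i) (s 0 i))].
Proof.
move=> T N.
have attB := att_bij R l a x y hx hy.
have [n cardT nE] := card_parameters R l x y hx hy.
have cardG : (aggregations R a x y #= `I_n)%card.
  (* Each attachment has exactly one result, so the tagged results are the image of [T] under a map
     that is injective already in its first component. *)
  have -> : aggregations R a x y = (fun s => (a - y + s,
      \row_(i < l) zcoord (x 0 i) (y 0 i) (s 0 i))) @` T.
    apply/seteqP; split=> [[b z] [/= attb agg]|_ [s Ts <-]].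
      case: attB => _ _ /(_ b attb)[s Ts sb]; exists s => //.
      by move: agg; rewrite -sb => /aggregates_att => ->.
    split; first by case: attB => + _ _; apply.
    exact/aggregates_att.
  apply: card_eq_trans (inj_card_eq _) cardT.
  by move=> s t _ _ [/addrI].
split.
- by exists (fun s => a - y + s).
- split; rewrite ?(card_fset_set cardT) ?(card_fset_set cardG) //.
    by exists n.
  by exists n.
- exists (fun s => a - y + s); split=> // s _ z; exact: aggregates_att.
Qed.
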